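(* Let $\mathcal{L}$ and $\mathcal{G}$ be first-order languages, let $A$ be an $\mathcal{L}$-structure and $B$ a $\mathcal{G}$-structure. Suppose that for every $m\in\mathbb{N}$ there are $d(m)\in\mathbb{N}$ and a function $f_m\colon B^m\to A^{d(m)}$ such that: (i) for every definable set $D\subseteq B^m$, the set $f_m(D)\subseteq A^{d(m)}$ is definable; (ii) for every quantifier-free definable set $E\subseteq A^{d(m)}$, the set $f_m^{-1}(E)\subseteq B^m$ is quantifier-free definable; (iii) for every $a\in A^{d(m)}$ and every definable set $D\subseteq B^m$, either $f_m^{-1}(a)\subseteq D$ or $f_m^{-1}(a)\cap D=\emptyset$. Then, if $A$ admits quantifier elimination, so does $B$. Furthermore, if (i) and (ii) are constructive and there is a constructive algorithm for quantifier elimination in $A$, then there is a constructive algorithm for quantifier elimination in $B$.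
   Context: For a structure $M$ over a language, a subset of $M^m$ is definable if it is the set of $m$-tuples satisfying some first-order formula of the language with $m$ free variables, and quantifier-free definable if such a formula can be chosen without quantifiers. $M$ admits quantifier elimination if every definable set is quantifier-free definable (i.e. for each formula $\phi(x_1,\dots,x_m)$ there is a quantifier-free formula $\psi(x_1,\dots,x_m)$ defining the same subset of $M^m$). Conditions (i) and (ii) are called constructive if there is an algorithm that turns a defining formula of a set into a defining formula of its image, respectively (a quantifier-free defining formula of a set into a quantifier-free defining formula of) its preimage, as required. *)

(* Defs.v *)
From mathcomp Require Import all_boot.
From mathcomp Require Import boolp classical_sets.

Set Implicit Arguments.
Unset Strict Implicit.
Unset Printing Implicit Defensive.

Local Open Scope classical_set_scope.

Record language := Language {
  fsym : Type;
  farity : fsym -> nat;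
  rsym : Type;
  rarity : rsym -> nat }.

Section Syntax.
Variable L : language.

Inductive term (n : nat) : Type :=
| Var of 'I_n
| App (f : fsym L) of 'I_(farity f) -> term n.

(* [formula n] consists of the formulas whose free variables are declared to
   be x_0, ..., x_(n-1). A quantifier binds x_0 of its body and shifts the
   other variables: x_(i+1) of the body is x_i outside. *)
Inductive formula : nat -> Type :=
| Bot n : formula n
| Eq n : term n -> term n -> formula n
| Rel n (r : rsym L) : ('I_(rarity r) -> term n) -> formula n
| Imp n : formula n -> formula n -> formula n
| And n : formula n -> formula n -> formula n
| Or n : formula n -> formula n -> formula n
| All n : formula n.+1 -> formula n
| Ex n : formula n.+1 -> formula n.

Fixpoint qfree n (phi : formula n) : bool :=
  match phi with
  | Bot _ | Eq _ _ _ | Rel _ _ _ => true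
  | Imp _ p q | And _ p q | Or _ p q => qfree p && qfree q
  | All _ _ | Ex _ _ => false
  end.

End Syntax.

Record structure (L : language) := Structure {
  carrier :> Type;
  fint : forall f : fsym L, (farity f).-tuple carrier -> carrier;
  rint : forall r : rsym L, (rarity r).-tuple carrier -> Prop }.

Section Semantics.
Variables (L : language) (M : structure L).

Fixpoint eval n (v : n.-tuple M) (t : term L n) : M :=
  match t with
  | Var i => tnth v i
  | App f ts => fint [tuple eval v (ts i) | i < farity f]
  end.

Fixpoint sat n (phi : formula L n) : n.-tuple M -> Prop :=
  match phi in formula _ n return n.-tuple M -> Prop with
  | Bot _ => fun _ => False
  | Eq _ s t => fun v => eval v s = eval v t
  | Rel _ r ts => fun v => rint [tuple eval v (ts i) | i < rarity r]
  | Imp _ p q => fun v => sat p v -> sat q v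
  | And _ p q => fun v => sat p v /\ sat q v
  | Or _ p q => fun v => sat p v \/ sat q v
  | All _ p => fun v => forall a : M, sat p [tuple of a :: v]
  | Ex _ p => fun v => exists a : M, sat p [tuple of a :: v]
  end.

Definition defines n (phi : formula L n) (D : set (n.-tuple M)) : Prop :=
  forall v, D v <-> sat phi v.

Definition definable n (D : set (n.-tuple M)) : Prop :=
  exists phi : formula L n, defines phi D.

Definition qf_definable n (D : set (n.-tuple M)) : Prop :=
  exists phi : formula L n, qfree phi /\ defines phi D.

Definition admits_QE : Prop :=
  forall n (D : set (n.-tuple M)), definable D -> qf_definable D.

End Semantics.

(* Partial recursive functions: [mu_rec k] is the type of programs with k
   inputs, and [computes p v y] says that p halts on v with output y. *)
Inductive mu_rec : nat -> Type :=
| Zero k : mu_rec k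
| Succ : mu_rec 1
| Proj k : 'I_k -> mu_rec k
| Comp k l : mu_rec l -> ('I_l -> mu_rec k) -> mu_rec k
| PrimRec k : mu_rec k -> mu_rec k.+2 -> mu_rec k.+1
| Mu k : mu_rec k.+1 -> mu_rec k.

Fixpoint computes k (p : mu_rec k) : k.-tuple nat -> nat -> Prop :=
  match p in mu_rec k return k.-tuple nat -> nat -> Prop with
  | Zero _ => fun _ y => y = 0
  | Succ => fun v y => y = (thead v).+1
  | Proj _ i => fun v y => y = tnth v i
  | Comp _ l g h => fun v y => exists w : l.-tuple nat,
      (forall j, computes (h j) v (tnth w j)) /\ computes g w y
  | PrimRec _ g h => fun v y => exists s : nat -> nat,
      [/\ computes g [tuple of behead v] (s 0),
          forall i, i < thead v ->
            computes h [tuple of [:: i, s i & behead v]] (s i.+1)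
        & y = s (thead v)]
  | Mu _ g => fun v y =>
      computes g [tuple of y :: v] 0 /\
      (forall i, i < y -> exists z, computes g [tuple of i :: v] z.+1)
  end.

(* A presentation of the symbols of L as numbers, so that formulas of L can be
   inputs and outputs of programs. *)
Record numbering (L : language) := Numbering {
  fnum : fsym L -> nat;
  rnum : rsym L -> nat;
  fnum_inj : injective fnum;
  rnum_inj : injective rnum }.

Section Goedel.
Variables (L : language) (nu : numbering L).

Fixpoint term_code n (t : term L n) : nat :=
  match t with
  | Var i => CodeSeq.code [:: 0; val i]
  | App f ts => CodeSeq.code
      [:: 1, fnum nu f & [seq term_code (ts i) | i <- enum 'I_(farity f)]]
  end.

Fixpoint formula_code n (phi : formula L n) : nat :=
  match phi with
  | Bot _ => CodeSeq.code [:: 0]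
  | Eq _ s t => CodeSeq.code [:: 1; term_code s; term_code t]
  | Rel _ r ts => CodeSeq.code
      [:: 2, rnum nu r & [seq term_code (ts i) | i <- enum 'I_(rarity r)]]
  | Imp _ p q => CodeSeq.code [:: 3; formula_code p; formula_code q]
  | And _ p q => CodeSeq.code [:: 4; formula_code p; formula_code q]
  | Or _ p q => CodeSeq.code [:: 5; formula_code p; formula_code q]
  | All _ p => CodeSeq.code [:: 6; formula_code p]
  | Ex _ p => CodeSeq.code [:: 7; formula_code p]
  end.

(* The code of phi(x_0, ..., x_(n-1)) records the number n of declared
   variables, i.e. the power M^n in which phi defines a set. *)
Definition goedel n (phi : formula L n) : nat :=
  CodeSeq.code [:: n; formula_code phi].

Definition constructive_QE (M : structure L) : Prop :=
  exists e : mu_rec 1, forall n (phi : formula L n),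
    exists psi : formula L n,
      [/\ qfree psi, defines psi [set v : n.-tuple M | sat phi v]
        & computes e [tuple goedel phi] (goedel psi)].

End Goedel.

Section Transfer.
Variables (L G : language) (A : structure L) (B : structure G).
Variables (d : nat -> nat) (f : forall m, m.-tuple B -> (d m).-tuple A).

Definition constructive_image (nuL : numbering L) (nuG : numbering G) : Prop :=
  exists e : mu_rec 1, forall m (phi : formula G m),
    exists psi : formula L (d m),
      defines psi (@f m @` [set v | sat phi v]) /\
      computes e [tuple goedel nuG phi] (goedel nuL psi).

(* m is an input because d need not be injective, so that the formula defining
   a subset of A^(d m) does not determine which preimage is meant. *)
Definition constructive_preimage (nuL : numbering L) (nuG : numbering G) :
    Prop :=
  exists e : mu_rec 2, forall m (psi : formula L (d m)), qfree psi ->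
    exists phi : formula G m,
      [/\ qfree phi, defines phi (@f m @^-1` [set w | sat psi w])
        & computes e [tuple m; goedel nuL psi] (goedel nuG phi)].

End Transfer.

(* Main.v *)
(** By (iii), D is a union of fibres of f_m, so D = f_m^-1(f_m(D)): eliminate
    quantifiers in f_m(D) and pull back. The algorithm for B is therefore the
    composite of the three given ones; as the preimage algorithm also wants m,
    the only new program is one that reads m off the Goedel number
    CodeSeq.code [:: m; k] = 2 ^ m * (2 ^ k).*2.+1, as a 2-adic valuation. *)

Require Import Defs.
From mathcomp Require Import all_boot.
From mathcomp Require Import boolp classical_sets.

Local Open Scope classical_set_scope.

(** If [x] shares its value with some [x'] in [D], the fibre through [x] meets [D], hence lies
    inside it. *)
Lemma preimage_image_saturated (X Y : Type) (g : X -> Y) (D : set X) :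
  (forall y, g @^-1` [set y] `<=` D \/ g @^-1` [set y] `&` D = set0) ->
  g @^-1` (g @` D) = D.
Proof.
move=> satD; apply/seteqP; split=> [x [x' Dx' gx'x]|x Dx]; last by exists x.
have [sD|D0] := satD (g x); first exact: sD.
by have: set0 x' by rewrite -D0; split.
Qed.

Lemma computes_comp1 k (p : mu_rec 1) (q : mu_rec k) v x y :
  computes q v x -> computes p [tuple x] y -> computes (Comp p (fun=> q)) v y.
Proof. by move=> qx py; exists [tuple x]; split=> // j; rewrite ord1. Qed.

Definition mu_not : mu_rec 1 :=
  PrimRec (Comp Succ (fun=> Zero 0)) (Zero 2).

Lemma computes_mu_not x : computes mu_not [tuple x] (x == 0).
Proof.
(* [PrimRec] asks for the whole sequence of intermediate values: here 1 at 0, then 0 forever. *)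
exists (fun i => nat_of_bool (i == 0)); split=> //=.
by exists [tuple 0]; split=> // j; rewrite ord1.
Qed.

Definition mu_even : mu_rec 1 :=
  PrimRec (Comp Succ (fun=> Zero 0))
    (Comp mu_not (fun=> Proj (@Ordinal 2 1 isT))).

Lemma computes_mu_even x : computes mu_even [tuple x] (~~ odd x).
Proof.
exists (fun i => nat_of_bool (~~ odd i)); split=> //.
  by exists [tuple 0]; split=> // j; rewrite ord1.
move=> i _; apply: computes_comp1; first exact: erefl.
by have := computes_mu_not (~~ odd i); rewrite eqb0.
Qed.

Definition mu_add : mu_rec 2 :=
  PrimRec (Proj (@Ordinal 1 0 isT)) (Comp Succ (fun=> Proj (@Ordinal 3 1 isT))).

Lemma computes_mu_add x y : computes mu_add [tuple x; y] (x + y).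
Proof.
exists (fun i => i + y); split=> // i _.
by apply: computes_comp1; first exact: erefl.
Qed.

(** The recursion is [i.+1./2 = odd i + i./2]; [Proj] 0 reads the counter [i], [Proj] 1 the previous
    value. *)
Definition mu_half : mu_rec 1 :=
  PrimRec (Zero 0)
    (Comp mu_add (fun j : 'I_2 =>
       if val j == 0
       then Comp mu_not (fun=> Comp mu_even (fun=> Proj (@Ordinal 2 0 isT)))
       else Proj (@Ordinal 2 1 isT))).

Lemma computes_mu_half x : computes mu_half [tuple x] x./2.
Proof.
exists half; split=> // i _; exists [tuple nat_of_bool (odd i); i./2]; split.
  case=> -[|[|//]] ltj //; apply: (computes_comp1 _ _ _ _ (~~ odd i)).
    by apply: computes_comp1; [exact: erefl | exact: computes_mu_even].
  by have := computes_mu_not (~~ odd i); rewrite eqb0 negbK.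
by rewrite -[i.+1./2]uphalfE uphalf_half; exact: computes_mu_add.
Qed.

Definition mu_iter_half : mu_rec 2 :=
  PrimRec (Proj (@Ordinal 1 0 isT)) (Comp mu_half (fun=> Proj (@Ordinal 3 1 isT))).

Lemma computes_mu_iter_half n x :
  computes mu_iter_half [tuple n; x] (iter n half x).
Proof.
exists (fun i => iter i half x); split=> // i _.
by apply: computes_comp1; [exact: erefl | exact: computes_mu_half].
Qed.

(** [mu_even] returns 0 on odd numbers, so the search stops at the least number of halvings that
    gives an odd result. *)
Definition mu_val2 : mu_rec 1 := Mu (Comp mu_even (fun=> mu_iter_half)).

Lemma iter_half_expn2M i n x :
  i <= n -> iter i half (2 ^ n * x) = 2 ^ (n - i) * x.
Proof.
elim: i => [|i IHi] ltin; first by rewrite subn0.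
by rewrite iterS IHi 1?ltnW // -(subnSK ltin) expnS -mulnA mul2n doubleK.
Qed.

(** After [i <= n] halvings [2 ^ (n - i)] times an odd number remains, which is even exactly when
    [i < n]. *)
Lemma computes_mu_val2 n x : computes mu_val2 [tuple 2 ^ n * x.*2.+1] n.
Proof.
have parity i : i <= n -> computes (Comp mu_even (fun=> mu_iter_half))
    [tuple i; 2 ^ n * x.*2.+1] (i < n).
  move=> lein; apply: computes_comp1; first exact: computes_mu_iter_half.
  have := computes_mu_even (2 ^ (n - i) * x.*2.+1).
  by rewrite iter_half_expn2M // oddM oddX /= odd_double /= orbF andbT
             subn_eq0 -ltnNge.
have tupleE i :
    [tuple of i :: [tuple 2 ^ n * x.*2.+1]] = [tuple i; 2 ^ n * x.*2.+1].
  exact: val_inj.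
split=> [|i ltin]; rewrite tupleE.
  by have := parity n (leqnn n); rewrite ltnn.
(* Before [n] the parity test outputs 1, the successor of this 0. *)
by exists 0; have := parity i (ltnW ltin); rewrite ltin.
Qed.

Theorem theorem2p1 (L G : language) (A : structure L) (B : structure G)
    (d : nat -> nat) (f : forall m : nat, m.-tuple B -> (d m).-tuple A)
    (Hi : forall (m : nat) (D : set (m.-tuple B)),
       definable D -> definable (f m @` D))
    (Hii : forall (m : nat) (E : set ((d m).-tuple A)),
       qf_definable E -> qf_definable (f m @^-1` E))
    (Hiii : forall (m : nat) (a : (d m).-tuple A) (D : set (m.-tuple B)),
       definable D ->
       f m @^-1` [set a] `<=` D \/ f m @^-1` [set a] `&` D = set0) :
  (admits_QE A -> admits_QE B) /\
  (forall (nuL : numbering L) (nuG : numbering G),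
     constructive_image f nuL nuG ->
     constructive_preimage f nuL nuG ->
     constructive_QE nuL A ->
     constructive_QE nuG B).
Proof.
have satB m (D : set (m.-tuple B)) : definable D -> f m @^-1` (f m @` D) = D.
  by move=> defD; apply: preimage_image_saturated => a; exact: Hiii.
split=> [qeA m D defD|nuL nuG [im imP] [pre preP] [qe qeP]].
  by rewrite -(satB m D defD); apply/Hii/qeA/Hi.
(* Input 0 of [pre] is [m], input 1 the quantifier-free formula for the image. *)
exists (Comp pre (fun j : 'I_2 =>
  if val j == 0 then mu_val2 else Comp qe (fun=> im))) => m phi.
have [psi [psiP im_psi]] := imP m phi.
have [chi [qf_chi chiP qe_chi]] := qeP _ psi.
have [theta [qf_theta thetaP pre_theta]] := preP m chi qf_chi.
exists theta; split=> //.
  rewrite -[X in defines _ X]satB; last by exists phi.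
  (* [psi] and [chi] define the same set, the image under [f m], and [theta] defines its
     preimage. *)
  move=> v; rewrite -(thetaP v).
  by split=> [/psiP/chiP|/chiP/psiP].
exists [tuple m; goedel nuL chi]; split=> // -[[|[|//]] ltj] /=.
  (* By conversion, with [x] equal to [2 ^ formula_code nuG phi * 1]. *)
  exact: computes_mu_val2.
exact: computes_comp1 im_psi qe_chi.
Qed.
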